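(* For each integer $m\ge 2$ there are (on $\mathbf{C}^n$ for some $n$) Hermitian symmetric polynomials $q$ and $r$ such that the following hold: \begin{itemize} \item $q$ and $r$ are each bihomogeneous of degree $(2^{m-1},2^{m-1})$. \item $\mathbf{s}(q)=(2^{m-1}+1,0)$. \item $\mathbf{s}(r)=(2^{m-2}+1,2^{m-2})$. \item $\mathbf{s}(qr)=(2,0)$. \end{itemize}
   Context: A Hermitian symmetric polynomial on $\mathbf{C}^n$ is a polynomial $p(z,\overline{w})=\sum_{\alpha,\beta}c_{\alpha\beta}z^\alpha\overline{w}^\beta$ whose coefficient matrix $(c_{\alpha\beta})$ is Hermitian; it is identified with the real-valued function $p(z,\overline z)$. The signature pair $\mathbf{s}(p)=(A,B)$ means that the coefficient matrix has $A$ positive and $B$ negative eigenvalues. $p$ is bihomogeneous of degree $(d,d)$ if it is homogeneous of degree $d$ in $z$ and of degree $d$ in $\overline z$. *)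

(* Defs.v *)
From HB Require Import structures.
From mathcomp Require Import all_boot all_order all_algebra.
From mathcomp Require Import complex reals mpoly.
Set Implicit Arguments.
Unset Strict Implicit.
Unset Printing Implicit Defensive.
Import Order.TTheory GRing.Theory Num.Theory.
Local Open Scope ring_scope.

(* A polynomial p(z, conj w) on C^n is an element of {mpoly C[n + n]}: the
   first n variables are z, the last n stand for conj w. *)

(* The exponent of z^a (conj w)^b. *)
Definition bimnm (n : nat) (a b : 'X_{1..n}) : 'X_{1..n + n} :=
  [multinom match split i with inl j => a j | inr j => b j end | i < n + n].

Definition bicoef (C : numClosedFieldType) (n : nat) (p : {mpoly C[n + n]})
    (a b : 'X_{1..n}) : C :=
  p@_(bimnm a b).

(* Rows and columns run over the multi-indices of degree < msize p: these
   include every a and b with bicoef p a b != 0, and further multi-indices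
   would only add zero rows and columns. *)
Definition coefmx (C : numClosedFieldType) (n : nat) (p : {mpoly C[n + n]}) :
    'M[C]_(#|{: 'X_{1..n < msize p}}|) :=
  \matrix_(i, j) bicoef p (bmnm (enum_val i)) (bmnm (enum_val j)).

Definition hermitian_symmetric (C : numClosedFieldType) (n : nat)
    (p : {mpoly C[n + n]}) : bool :=
  coefmx p \is hermsymmx.

Definition bihomogeneous (C : numClosedFieldType) (n d e : nat)
    (p : {mpoly C[n + n]}) : Prop :=
  forall a b : 'X_{1..n}, bicoef p a b != 0 -> mdeg a = d /\ mdeg b = e.

(* The eigenvalues, repeated according to multiplicity. *)
Definition eigenvalues (C : numClosedFieldType) (N : nat) (A : 'M[C]_N) :
    seq C :=
  sval (closed_field_poly_normal (char_poly A)).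

(* On a numClosedFieldType, 0 < x and x < 0 both entail that x is real. *)
Definition signature (C : numClosedFieldType) (n : nat)
    (p : {mpoly C[n + n]}) : nat * nat :=
  let s := eigenvalues (coefmx p) in
  (count (fun x => 0 < x) s, count (fun x => x < 0) s).

(* Main.v *)
Require Import Defs.
From HB Require Import structures.
From mathcomp Require Import all_boot all_order all_algebra.
From mathcomp Require Import complex reals mpoly.
From mathcomp Require Import zify ring.
Set Implicit Arguments.
Unset Strict Implicit.
Unset Printing Implicit Defensive.
Import Order.TTheory GRing.Theory Num.Theory.
Local Open Scope ring_scope.

(** Take n = 2 and put x = |z_1|^2, y = |z_2|^2. A real polynomial in x and y
    has a diagonal coefficient matrix, so its signature counts the signs of its
    coefficients. With d = 2^(m-1), the polynomial X^(2d) + 1 is the product of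
    P(X) and P(-X), where P collects the factors X^2 + c X + 1 with c > 0, and
    all d + 1 coefficients of P are positive. Homogenizing P(X) and P(-X) gives
    q and r, with q r = x^(2d) + y^(2d). The numbers c are produced without
    trigonometry: if X^N + 1 is the product of the X^2 + a X + 1, substituting
    X^2 for X splits each factor into X^2 + c X + 1 and X^2 - c X + 1 with
    c = sqrt(2 - a). *)

(** * Multi-indices in two variables, and pairs of them *)

Definition mon2 (d i : nat) : 'X_{1..2} :=
  [multinom if k == ord0 then i else (d - i)%N | k < 2].

Lemma mon2_0 d i : mon2 d i ord0 = i.
Proof. by rewrite mnmE. Qed.

Lemma mdeg_mon2 d i : (i <= d)%N -> mdeg (mon2 d i) = d.
Proof. by move=> le_id; rewrite mdegE 2!big_ord_recl big_ord0 !mnmE /=; lia. Qed.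

Lemma mon2_inj d : injective (mon2 d).
Proof. by move=> i j eq_ij; rewrite -(mon2_0 d i) eq_ij mon2_0. Qed.

(** The exponents of degree d in two variables are thus indexed by 0..d, like the coefficients of a
    polynomial of degree at most d. *)
Lemma mon2E d (a : 'X_{1..2}) : mdeg a = d -> a = mon2 d (a ord0).
Proof.
rewrite mdegE 2!big_ord_recl big_ord0 => <-; apply/mnmP => i; rewrite mnmE.
case: (unliftP ord0 i) => [j ->|-> //]; rewrite (ord1 j) /=.
by rewrite addn0 addKn.
Qed.

Lemma mon2D d e i j : (i <= d)%N -> (j <= e)%N ->
  (mon2 d i + mon2 e j)%MM = mon2 (d + e) (i + j).
Proof.
by move=> le_id le_je; apply/mnmP => k; rewrite mnmDE !mnmE; case: ifP => _; lia.
Qed.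

Lemma bimnmD n (a b a' b' : 'X_{1..n}) :
  (bimnm a b + bimnm a' b')%MM = bimnm (a + a') (b + b').
Proof.
by apply/mnmP => i; rewrite mnmDE !mnmE; case: split => j; rewrite mnmDE.
Qed.

Lemma bimnm_inj n (a b a' b' : 'X_{1..n}) :
  bimnm a b = bimnm a' b' -> a = a' /\ b = b'.
Proof.
move=> /mnmP eq_ab; split; apply/mnmP => i.
  by have := eq_ab (lshift n i); rewrite !mnmE (unsplitK (inl i)).
by have := eq_ab (rshift n i); rewrite !mnmE (unsplitK (inr i)).
Qed.

Lemma mdeg_bimnm n (a b : 'X_{1..n}) : mdeg (bimnm a b) = (mdeg a + mdeg b)%N.
Proof.
rewrite !mdegE big_split_ord; congr (_ + _)%N; apply: eq_bigr => i _.
  by rewrite mnmE (unsplitK (inl i)).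
by rewrite mnmE (unsplitK (inr i)).
Qed.

(** * Bihomogenization and its diagonal coefficient matrix *)

Section Bihomogenization.

Variable C : numClosedFieldType.
Implicit Types p q : {poly C}.

(* With x = |z_1|^2 and y = |z_2|^2 this is y^d p(x / y), provided
   deg p <= d. *)
Definition bihom (d : nat) (p : {poly C}) : {mpoly C[2 + 2]} :=
  \sum_(i < d.+1) p`_i *: 'X_[bimnm (mon2 d i) (mon2 d i)].

Lemma bihom_is_linear d : linear (bihom d).
Proof.
move=> c p q; rewrite scaler_sumr -big_split; apply: eq_bigr => i _ /=.
by rewrite coefD coefZ scalerDl scalerA.
Qed.

HB.instance Definition _ d :=
  GRing.isLinear.Build C {poly C} {mpoly C[2 + 2]} _ (bihom d)
    (bihom_is_linear d).

Lemma bihomXn d i : (i <= d)%N ->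
  bihom d 'X^i = 'X_[bimnm (mon2 d i) (mon2 d i)].
Proof.
rewrite -ltnS => lt_id; rewrite /bihom (bigD1 (Ordinal lt_id)) //= coefXn eqxx.
rewrite scale1r big1 ?addr0 // => j; rewrite -val_eqE /= => /negPf neq_ji.
by rewrite coefXn neq_ji scale0r.
Qed.

Lemma poly_sumX d p : (size p <= d.+1)%N -> p = \sum_(i < d.+1) p`_i *: 'X^i.
Proof.
move=> sz_p; rewrite -poly_def; apply/polyP => i; rewrite coef_poly.
by case: ltnP => // le_di; rewrite nth_default // (leq_trans sz_p).
Qed.

(** Both sides are bilinear in p and q, so monomials suffice, and there exponents add. The size
    bounds ensure that [bihom] drops no coefficient. *)
Lemma bihomM d e p q : (size p <= d.+1)%N -> (size q <= e.+1)%N ->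
  bihom d p * bihom e q = bihom (d + e) (p * q).
Proof.
move=> sz_p sz_q; rewrite [in RHS](poly_sumX sz_p) [in RHS](poly_sumX sz_q).
rewrite [X in _ = bihom _ X]big_distrlr /= linear_sum.
rewrite {1}/bihom {1}/bihom big_distrlr; apply: eq_bigr => i _ /=.
rewrite linear_sum; apply: eq_bigr => j _ /=.
have le_id : (i <= d)%N by rewrite -ltnS.
have le_je : (j <= e)%N by rewrite -ltnS.
rewrite -!scalerAl -!scalerAr -exprD !linearZ /= bihomXn ?leq_add //.
by rewrite -mpolyXD bimnmD mon2D // !scalerA mulrC.
Qed.

(** Each term of [bihom] has the same exponent in z and in conj z, so it sits on the diagonal, in a
    row of degree d. *)
Lemma bicoef_bihom d p a b :
  bicoef (bihom d p) a b =
    if (a == b) && (mdeg a == d) then p`_(a ord0) else 0.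
Proof.
rewrite /bicoef raddf_sum /=.
case: ifP => [/andP [/eqP <- /eqP deg_a]|ne_ab].
  have lt_ad : (a ord0 < d.+1)%N.
    by rewrite ltnS -deg_a mdegE big_ord_recl leq_addr.
  rewrite (bigD1 (Ordinal lt_ad)) //= mcoeffZ mcoeffX -(mon2E deg_a).
  rewrite eqxx mulr1 big1 ?addr0 // => i.
  rewrite -val_eqE /= => neq_i; rewrite mcoeffZ mcoeffX.
  case: eqP => [/bimnm_inj [eq_i _]|]; last by rewrite mulr0.
  by rewrite -eq_i mon2_0 eqxx in neq_i.
apply: big1 => i _; rewrite mcoeffZ mcoeffX.
case: eqP => [/bimnm_inj [eq_a eq_b]|]; last by rewrite mulr0.
by rewrite -eq_a -eq_b eqxx mdeg_mon2 ?eqxx // -ltnS in ne_ab.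
Qed.

Lemma bihom_bihomogeneous d p : bihomogeneous d d (bihom d p).
Proof.
move=> a b; rewrite bicoef_bihom; case: ifP => [/andP [/eqP <- /eqP]//|].
by rewrite eqxx.
Qed.

Lemma coefmx_bihom_diag d p : is_diag_mx (coefmx (bihom d p)).
Proof.
apply/is_diag_mxP => i j neq_ij; rewrite mxE bicoef_bihom.
by rewrite (inj_eq val_inj) (inj_eq enum_val_inj) -val_eqE (negPf neq_ij).
Qed.

Lemma bihom_hermitian d p : (forall i, p`_i \is Num.real) ->
  hermitian_symmetric (bihom d p).
Proof.
move=> p_real; apply/is_hermitianmxP; rewrite expr0 scale1r.
apply/matrixP => i j; rewrite !mxE !bicoef_bihom [in RHS]eq_sym.
case: eqP => [->|_] /=; last by rewrite conjC0.
by case: ifP => _; rewrite ?conjC0 // conj_Creal.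
Qed.

(** The characteristic polynomial is the product of the X - A i i, and linear factors are unique up
    to order; the chosen root list comes in no specified order. *)
Lemma eigenvalues_diag N (A : 'M[C]_N) : is_diag_mx A ->
  perm_eq (eigenvalues A) [seq A i i | i : 'I_N].
Proof.
move=> A_diag; rewrite /eigenvalues.
case: closed_field_poly_normal => s /= def_s; apply: prod_XsubC_eq.
move: def_s; rewrite (monicP (char_poly_monic A)) scale1r => <-.
by rewrite char_poly_trig ?is_diag_mx_is_trig // big_image.
Qed.

(** Rows of degree other than d have diagonal entry 0, and so do indices i whose row lies beyond the
    matrix; since P rejects 0, neither is counted. *)
Lemma count_eigenvalues_bihom d p (P : pred C) : ~~ P 0 ->
  count P (eigenvalues (coefmx (bihom d p))) =
    count (fun i => P p`_i) (iota 0 d.+1).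
Proof.
move=> P0; rewrite (permP (eigenvalues_diag (coefmx_bihom_diag d p))).
set K := msize (bihom d p).
pose s := [seq mon2 d i | i <- iota 0 d.+1 & P p`_i].
pose t := [seq bmnm a | a <- enum {: 'X_{1..2 < K}}
             & P (bicoef (bihom d p) (bmnm a) (bmnm a))].
have -> : count (fun i => P p`_i) (iota 0 d.+1) = size s.
  by rewrite size_map size_filter.
have -> : count P [seq coefmx (bihom d p) i i | i : 'I__] = size t.
  rewrite -!sum1_count size_map size_filter -sum1_count big_image_cond.
  rewrite big_enum_cond [RHS]big_enum_val_cond /=.
  by apply: eq_bigl => i; rewrite /= mxE.
apply/perm_size/uniq_perm.
- rewrite map_inj_uniq; last exact: val_inj.
  exact: filter_uniq (enum_uniq _).
- by rewrite map_inj_uniq ?filter_uniq ?iota_uniq //; apply: mon2_inj.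
move=> a; apply/mapP/mapP => [[b] | [ i ]]; rewrite mem_filter.
  case/andP; rewrite bicoef_bihom eqxx; case: eqP => [deg_b Pb _ ->|]; last first.
    by rewrite (negPf P0).
  exists (b ord0); last exact: mon2E.
  by rewrite mem_filter Pb mem_iota /= ltnS -deg_b mdegE big_ord_recl leq_addr.
rewrite mem_iota add0n ltnS => /andP [Pi le_id] ->.
have Pa : P (bicoef (bihom d p) (mon2 d i) (mon2 d i)).
  by rewrite bicoef_bihom mdeg_mon2 ?eqxx //= mon2_0.
(* A nonzero coefficient puts the doubled exponent in the support, so its degree is below [msize]
   and the row exists. *)
have lt_aK : (mdeg (mon2 d i) < K)%N.
  rewrite (leq_ltn_trans (leq_addr (mdeg (mon2 d i)) _)) // -mdeg_bimnm.
  rewrite msize_mdeg_lt // mcoeff_msupp; apply: contraNneq P0 => eq0.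
  by move: Pa; rewrite /bicoef eq0.
by exists (BMultinom lt_aK) => [|//]; rewrite mem_filter mem_enum /= Pa.
Qed.

Lemma signature_bihom d p :
  signature (bihom d p) =
    (count (fun i => 0 < p`_i) (iota 0 d.+1),
     count (fun i => p`_i < 0) (iota 0 d.+1)).
Proof. by rewrite /signature !count_eigenvalues_bihom ?ltxx. Qed.

End Bihomogenization.

(** * Factoring X^(2d) + 1 with positive coefficients *)

Section Factorization.

Variable C : numClosedFieldType.
Implicit Types p q : {poly C}.

Definition pos_coefs (d : nat) (p : {poly C}) : Prop :=
  (size p <= d.+1)%N /\ forall i, (i <= d)%N -> 0 < p`_i.

Lemma pos_coefsM d e p q :
  pos_coefs d p -> pos_coefs e q -> pos_coefs (d + e) (p * q).
Proof.
move=> [sz_p p_gt0] [sz_q q_gt0]; split=> [|i le_i].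
  by rewrite (leq_trans (size_polyMleq _ _)) //; lia.
have ge0 f r j : (size r <= f.+1)%N -> (forall j, (j <= f)%N -> 0 < r`_j) ->
    0 <= r`_j :> C.
  move=> sz_r r_gt0; have [/r_gt0/ltW //|lt_fj] := leqP j f.
  by rewrite nth_default // (leq_trans sz_r).
(* One summand of the convolution is strictly positive: with j = min(i, d), both j <= d and i - j <=
   e hold. *)
have lt_mi : (minn i d < i.+1)%N by lia.
rewrite coefM (bigD1 (Ordinal lt_mi)) //= ltr_pwDl //.
  by rewrite mulr_gt0 ?p_gt0 ?q_gt0 //; lia.
by apply: sumr_ge0 => j _; apply: mulr_ge0;
  [exact: ge0 sz_p p_gt0 | exact: ge0 sz_q q_gt0].
Qed.

(** For -2 < a < 2 the roots are two conjugate numbers of modulus 1, as are the roots of X^N + 1. *)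
Definition quad (a : C) : {poly C} := 'X^2 + a *: 'X + 1.

Lemma coef_quad a i : (quad a)`_i = (i == 2)%:R + a * (i == 1)%:R + (i == 0)%:R.
Proof. by rewrite !coefD coefZ coefXn coefX coef1. Qed.

Lemma pos_coefs_quad a : 0 < a -> pos_coefs 2 (quad a).
Proof.
move=> a_gt0; split=> [|i].
  by apply/leq_sizeP => -[|[|[|i]]] // _; rewrite coef_quad /= mulr0 !addr0.
by case: i => [|[|[|//]]] _; rewrite coef_quad /= ?mulr0 ?mulr1 ?addr0 ?add0r.
Qed.

Lemma pos_coefs_prod_quad (s : seq C) : all (fun a => 0 < a) s ->
  pos_coefs (2 * size s) (\prod_(a <- s) quad a).
Proof.
elim: s => [_|a s IHs /= /andP [a_gt0 /IHs pos_s]].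
  rewrite big_nil; split=> [|[|//] _]; first by rewrite size_poly1.
  by rewrite coef1.
by rewrite big_cons mulnS; apply: pos_coefsM => //; apply: pos_coefs_quad.
Qed.

Lemma quad_compN a : quad a \Po (- 'X) = quad (- a).
Proof.
rewrite /quad !comp_polyD comp_polyZ comp_Xn_poly comp_polyX comp_polyC.
by rewrite -!mul_polyC polyCN; ring.
Qed.

(* X^4 + a X^2 + 1 = (X^2 + 1)^2 - (2 - a) X^2 *)
Lemma quad_compX2 a :
  quad (sqrtC (2 - a)) * quad (- sqrtC (2 - a)) = quad a \Po 'X^2.
Proof.
rewrite /quad !comp_polyD comp_polyZ comp_Xn_poly comp_polyX comp_polyC.
have : (sqrtC (2 - a))%:P ^+ 2 = 2 - a%:P :> {poly C}.
  by rewrite -polyC_exp sqrtCK polyCB polyC_natr.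
rewrite -!mul_polyC polyCN => def_c; ring: def_c.
Qed.

Lemma prod_quad_compX2 (s : seq C) :
  \prod_(a <- s) (quad (sqrtC (2 - a)) * quad (- sqrtC (2 - a))) =
    (\prod_(a <- s) quad a) \Po 'X^2.
Proof. by rewrite rmorph_prod; apply: eq_bigr => a _; apply: quad_compX2. Qed.

(** The bounds on a are the invariant of the induction: a < 2 makes sqrt(2 - a) positive and -2 < a
    makes it less than 2, so both of its signs stay in the interval. *)
Lemma Xn1_factorization k : exists s : seq C,
  [/\ size s = (2 ^ k)%N, all (fun a => (-2 < a) && (a < 2)) s
    & \prod_(a <- s) quad a = 'X^(2 ^ k.+1) + 1].
Proof.
elim: k => [|k [s [sz_s s_lt2 prod_s]]].
  exists [:: 0]; split; rewrite //= ?oppr_lt0 ?ltr0n //.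
  by rewrite big_seq1 /quad scale0r addr0.
pose f a : C := sqrtC (2 - a).
exists ([seq f a | a <- s] ++ [seq - f a | a <- s]); split.
- by rewrite size_cat !size_map sz_s expnS; lia.
- rewrite all_cat !all_map -all_predI.
  apply/allP => a /(allP s_lt2) /andP [gt_a lt_a].
  have f_gt0 : 0 < f a by rewrite sqrtC_gt0 subr_gt0.
  have f_lt2 : f a < 2.
    rewrite -(@ltr_pXn2r _ 2) ?nnegrE ?ltW ?ltr0n // sqrtCK.
    by rewrite -subr_gt0 (_ : _ - _ = a - -2) ?subr_gt0 //; ring.
  have Nf_lt0 : - f a < 0 by rewrite oppr_lt0.
  have lt02 : (0 : C) < 2 by rewrite ltr0n.
  have ltN20 : (-2 : C) < 0 by rewrite oppr_lt0.
  by rewrite /= ltrN2 f_lt2 (lt_trans ltN20 f_gt0) (lt_trans Nf_lt0 lt02).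
rewrite big_cat !big_map /= -big_split /= prod_quad_compX2 prod_s.
by rewrite comp_polyD comp_Xn_poly comp_polyC -exprM -expnS.
Qed.

(** One more substitution of X^2 for X, in which the positive square roots go to p and the negative
    ones to p(-X). *)
Lemma pos_coefs_factorization k : exists2 p,
  pos_coefs (2 ^ k.+1) p & p * (p \Po (- 'X)) = 'X^(2 ^ k.+1 + 2 ^ k.+1) + 1.
Proof.
have [s [sz_s s_lt2 prod_s]] := Xn1_factorization k.
pose t := [seq sqrtC (2 - a) | a <- s].
exists (\prod_(a <- t) quad a).
  rewrite expnS -sz_s -(size_map (fun a => sqrtC (2 - a)) s).
  apply: pos_coefs_prod_quad; rewrite all_map; apply/allP => a.
  by move=> /(allP s_lt2) /andP [_ lt_a]; rewrite /= sqrtC_gt0 subr_gt0.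
rewrite rmorph_prod -big_split big_map /=.
under eq_bigr do rewrite quad_compN.
by rewrite prod_quad_compX2 prod_s comp_polyD comp_Xn_poly comp_polyC -exprM
  mul2n -addnn.
Qed.

Lemma coef_compN p i : (p \Po (- 'X))`_i = (-1) ^+ i * p`_i.
Proof.
have -> : p \Po (- 'X) = \poly_(j < size p) ((-1) ^+ j * p`_j).
  rewrite comp_polyE poly_def; apply: eq_bigr => j _.
  by rewrite -['X in LHS]scale1r -scaleNr exprZn scalerA mulrC.
rewrite coef_poly; case: ltnP => // le_pi.
by rewrite nth_default ?mulr0.
Qed.

End Factorization.

(** * Counting signs, and the theorem *)

Lemma count_odd_iota n :
  count odd (iota 0 (2 * n).+1) = n /\
  count (fun i => ~~ odd i) (iota 0 (2 * n).+1) = n.+1.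
Proof.
elim: n => [//|n [IHo IHe]].
have -> : ((2 * n.+1).+1 = (2 * n).+1 + 2)%N by lia.
rewrite iotaD !count_cat IHo IHe add0n mul2n /= odd_double /=; lia.
Qed.

Theorem proposition4p1 (R : realType) (m : nat) (m_ge2 : (2 <= m)%N) :
  exists (n : nat) (q r : {mpoly R[i][n + n]}),
    (hermitian_symmetric q /\ hermitian_symmetric r) /\
    (bihomogeneous (2 ^ (m - 1)) (2 ^ (m - 1)) q /\
     bihomogeneous (2 ^ (m - 1)) (2 ^ (m - 1)) r) /\
    signature q = ((2 ^ (m - 1) + 1)%N, 0%N) /\
    signature r = ((2 ^ (m - 2) + 1)%N, (2 ^ (m - 2))%N) /\
    signature (q * r) = (2%N, 0%N).
Proof.
(* With m = k + 2, the degree is 2^(k+1) and 2^(m-2) becomes 2^k. *)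
case: m m_ge2 => [|[|k]] // _; rewrite !subSS !subn0.
have [p [sz_p p_gt0] def_pN] := pos_coefs_factorization R[i] k.
set d := (2 ^ k.+1)%N in sz_p p_gt0 def_pN *.
have sz_pN : (size (p \Po (- 'X)) <= d.+1)%N.
  by apply/leq_sizeP => i le_i; rewrite coef_compN (leq_sizeP _ _ sz_p) ?mulr0.
have p_real i : p`_i \is Num.real.
  have [/p_gt0/gtr0_real //|lt_di] := leqP i d.
  by rewrite (leq_sizeP _ _ sz_p) // real0.
have pN_real i : (p \Po (- 'X))`_i \is Num.real.
  by rewrite coef_compN rpredM // rpredX // rpredN rpred1.
have all_d (P Q : pred nat) : {in [pred i | i <= d]%N, P =1 Q} ->
    count P (iota 0 d.+1) = count Q (iota 0 d.+1).
  by move=> eqPQ; apply: eq_in_count => i; rewrite mem_iota ltnS; apply: eqPQ.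
exists 2, (bihom d p), (bihom d (p \Po (- 'X))).
split; first by split; apply: bihom_hermitian.
split; first by split; apply: bihom_bihomogeneous.
(* The coefficients of p(-X) alternate in sign, so the signature of r counts even and odd indices up
   to d = 2 * 2^k. *)
have pN_sgn i : (i <= d)%N -> ((0 < (p \Po (- 'X))`_i) = ~~ odd i) *
    (((p \Po (- 'X))`_i < 0) = odd i).
  move=> /p_gt0 pi_gt0; rewrite coef_compN -signr_odd.
  case: odd; rewrite ?expr0 ?mul1r ?expr1 ?mulN1r ?oppr_gt0 ?oppr_lt0 pi_gt0.
    by rewrite lt_gtF.
  by rewrite lt_gtF.
have [odd_d even_d] := count_odd_iota (2 ^ k).
rewrite -expnS -/d in odd_d even_d.
split.
  rewrite signature_bihom (all_d _ predT) => [|i /p_gt0 -> //].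
  rewrite count_predT size_iota addn1 (all_d _ pred0) ?count_pred0 //.
  by move=> i /p_gt0 /lt_gtF.
split.
  rewrite signature_bihom (all_d _ (fun i => ~~ odd i)) => [|i /pN_sgn -> //].
  by rewrite even_d addn1 (all_d _ odd) ?odd_d // => i /pN_sgn ->.
rewrite bihomM // def_pN signature_bihom.
(* Writing 2d as N + 1 makes the two exponents 0 and 2d distinct, so that they count as two positive
   coefficients and not one. *)
have : (0 < d + d)%N by rewrite addn_gt0 expn_gt0.
case: (d + d)%N => // N _.
have XN1_ge0 i : 0 <= ('X^(N.+1) + 1 : {poly R[i]})`_i.
  by rewrite coefD coefXn coef1 addr_ge0 ?ler0n.
congr pair; last first.
  by rewrite (eq_count (a2 := pred0)) ?count_pred0 // => i; rewrite le_gtF.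
have XN1_gt0 i : (0 < ('X^(N.+1) + 1 : {poly R[i]})`_i) = (i == 0) || (i == N.+1).
  rewrite lt0r XN1_ge0 andbT coefD coefXn coef1 -natrD pnatr_eq0.
  by case: (i == 0); case: (i == N.+1).
rewrite (eq_count XN1_gt0) -[N.+2]addn1 iotaD count_cat /= add0n addn0.
(* The end indices 0 and N + 1 have been split off; the rest, 1..N, contributes nothing. *)
rewrite (@eq_in_count _ _ pred0) ?count_pred0 ?eqxx ?orbT // => i.
by rewrite mem_iota /=; lia.
Qed.
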